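(* Let $\Bbbk$ be a field of characteristic $p\neq2$ and let $r\ge1$ be an integer. For $\Phi^{(r)}_{1|1}:\Bbbk S_r\to\mathrm{End}_{GL(1|1)}(V_{1|1}^{\otimes r})$ we have $$\dim_{\Bbbk}\mathrm{End}_{GL(1|1)}(V_{1|1}^{\otimes r})=\binom{2r-2}{r-1}=\dim_{\Bbbk}\mathrm{im}\,\Phi^{(r)}_{1|1}.$$
   Context: $V=V_{1|1}=\Bbbk^{1|1}$ is the super vector space over $\Bbbk$ with one-dimensional even part and one-dimensional odd part. $GL(1|1)$ is the affine group superscheme over $\Bbbk$ sending a supercommutative $\Bbbk$-superalgebra $R$ to the group of parity-preserving $R$-linear automorphisms of $V\otimes R$; it acts diagonally on $V^{\otimes r}$, and $\mathrm{End}_{GL(1|1)}(V^{\otimes r})$ is the algebra of (parity-preserving) $\Bbbk$-linear endomorphisms commuting with this action. The symmetric group $S_r$ acts on $V^{\otimes r}$ by $$\sigma(v_1\otimes\cdots\otimes v_r)=(-1)^{\langle\sigma;v_1,\dots,v_r\rangle}\,v_{\sigma^{-1}1}\otimes\cdots\otimes v_{\sigma^{-1}r}$$ for homogeneous $v_i$, where $\langle\sigma;v_1,\dots,v_r\rangle=\#\{1\le k<l\le r\mid \sigma k>\sigma l,\ v_k \text{ and } v_l \text{ odd}\}$. This commutes with $GL(1|1)$ and gives the algebra morphism $\Phi^{(r)}_{1|1}$. The characteristic may be $0$. *)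

(* Defs.v *)
From HB Require Import structures.
From mathcomp Require Import all_boot all_order all_fingroup all_algebra.
From mathcomp Require Import boolp.

Set Implicit Arguments.
Unset Strict Implicit.
Unset Printing Implicit Defensive.

Import GRing.Theory.
Local Open Scope ring_scope.

Section VspaceOf.
Variables (k : fieldType) (vT : vectType k) (P : vT -> Prop).
Hypotheses (P0 : P 0) (PL : forall a u v, P u -> P v -> P (a *: u + v)).

Lemma vspace_of_exists : exists U : {vspace vT}, forall v, v \in U <-> P v.
Proof.
pose Q n := `[< exists U : {vspace vT}, (forall v, v \in U -> P v) /\ \dim U = n >].
have exQ : exists n, Q n.
  exists 0%N; apply/asboolP; exists 0%VS; split; last exact: dimv0.
  by move=> v; rewrite memv0 => /eqP->.
have ubQ n : Q n -> (n <= \dim {:vT})%N.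
  by move=> /asboolP[U [_ <-]]; apply: dimvS; apply: subvf.
case: (ex_maxnP exQ ubQ) => n /asboolP[U [UP <-]] maxU.
exists U => v; split; first exact: UP.
move=> Pv; have: (\dim (<[v]> + U)%VS <= \dim U)%N.
  apply: maxU; apply/asboolP; exists (<[v]> + U)%VS; split=> // w.
  by case/memv_addP=> _ /vlineP[a ->] [u /UP Pu ->]; apply: PL.
rewrite (geq_leqif (dimv_leqif_sup (addvSr _ _))) => /subvP; apply.
by have /subvP sub := addvSl <[v]>%VS U; apply: sub; apply: memv_line.
Qed.

Definition vspace_of : {vspace vT} := projT1 (cid vspace_of_exists).

Lemma vspace_ofP v : v \in vspace_of <-> P v.
Proof. by rewrite /vspace_of; case: cid. Qed.

End VspaceOf.

(* The grading R = R_0 (+) R_1 is given by its two projections, [hpart false]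
   onto the even part and [hpart true] onto the odd part.  No separate axiom
   "a ^+ 2 = 0 for a odd" is imposed: it follows from [homogC] when 2 is
   invertible. *)
Record superCommAlg (k : fieldType) := SuperCommAlg {
  sca_alg :> algType k;
  hpart : bool -> {linear sca_alg -> sca_alg};
  homog p a := hpart p a = a;
  hpartD : forall a, hpart false a + hpart true a = a;
  hpartK : forall p q a, hpart p (hpart q a) = if p == q then hpart q a else 0;
  homog1 : homog false 1;
  homogM : forall p q a b, homog p a -> homog q b -> homog (p (+) q) (a * b);
  homogC : forall p q a b, homog p a -> homog q b ->
             a * b = (-1) ^+ (p && q) * (b * a)
}.
Arguments hpart {k s} p : rename.
Arguments homog {k s} p a : rename.

Section Coordinates.
Variable r : nat.

(* The even basis vector of V = k^{1|1} is indexed by [false], the odd one by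
   [true]; V (x) R is the free right R-module on them.  The basis vector
   e_{w 1} (x) ... (x) e_{w r} of the r-th tensor power is indexed by the
   word w. *)
Definition word : finType := {ffun 'I_r -> bool}.
Definition superV (R : Type) := {ffun bool -> R}.
Definition tensorV (R : Type) := {ffun word -> R}.

Definition basisV (R : pzRingType) (i : bool) : superV R :=
  [ffun j => (j == i)%:R].
Definition basisT (R : pzRingType) (w : word) : tensorV R :=
  [ffun v => (v == w)%:R].

Definition word_parity (w : word) : bool := \big[addb/false]_(i < r) w i.

End Coordinates.

Definition rscale (I : finType) (R : pzRingType) (x : {ffun I -> R}) (a : R)
  : {ffun I -> R} := [ffun i => x i * a].

Section GL.
Variables (k : fieldType) (R : superCommAlg k) (r : nat).

Definition homogV (p : bool) (x : superV R) :=
  forall i, homog (p (+) i) (x i).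

Record GL11 := MkGL11 {
  gl_fun :> superV R -> superV R;
  glD : {morph gl_fun : x y / x + y};
  glZ : forall x a, gl_fun (rscale x a) = rscale (gl_fun x) a;
  gl_parity : forall p x, homogV p x -> homogV p (gl_fun x);
  gl_bij : bijective gl_fun
}.

(* a |-> (-1)^{b |a|} a *)
Definition twist (b : bool) (a : R) : R :=
  hpart false a + (-1) ^+ b * hpart true a.

(* x_1 (x)_R ... (x)_R x_r, under the identification of (V (x) R)^{(x)_R r}
   with V^{(x) r} (x) R.  In e_{w 1} a_1 (x) ... (x) e_{w r} a_r each
   coefficient a_i is moved to the right across the e_{w j} with i < j. *)
Definition tens (x : 'I_r -> superV R) : tensorV r R :=
  [ffun w => \prod_(i < r)
     twist (\big[addb/false]_(j < r | (i < j)%N) (w : word r) j) (x i (w i))].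

(* The right R-linear extension of
   e_{u 1} (x) ... (x) e_{u r} |-> g e_{u 1} (x) ... (x) g e_{u r};
   see [GL_act_tens]. *)
Definition GL_act (g : GL11) (y : tensorV r R) : tensorV r R :=
  \sum_(u : word r) rscale (tens (fun i => g (basisV R (u i)))) (y u).

(* f (x) id_R; no sign is needed, R standing on the right. *)
Definition base_change (f : 'End(tensorV r k^o)) (y : tensorV r R)
  : tensorV r R :=
  [ffun w => \sum_(u : word r) f (basisT k^o u) w *: y u].

End GL.

Section Signs.
Variables (k : fieldType) (R : superCommAlg k).
Implicit Types (a b : R) (I : Type).

Lemma twistE p (c : bool) a : homog p a -> twist c a = (-1) ^+ (p && c) * a.
Proof.
rewrite /twist => h; have e q : hpart q a = if q == p then a else 0.
  by rewrite -[in LHS]h hpartK h.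
by rewrite !e; case: p {h e}; case: c; rewrite /= ?add0r ?mulr0 ?addr0 ?mul1r.
Qed.

Lemma homog_twist p (c : bool) a : homog p a -> homog p (twist c a).
Proof.
by move=> h; rewrite (twistE _ h) /homog mulr_sign; case: ifP => _;
  rewrite ?linearN /= h.
Qed.

Lemma homog_prod I (s : seq I) (p : I -> bool) (b : I -> R) :
  (forall i, homog (p i) (b i)) ->
  homog (\big[addb/false]_(i <- s) p i) (\prod_(i <- s) b i).
Proof.
move=> hb; elim: s => [|x s IH]; first by rewrite !big_nil; apply: homog1.
by rewrite !big_cons; apply: homogM.
Qed.

Lemma prod_sign I (s : seq I) (c : I -> bool) (b : I -> R) :
  \prod_(i <- s) ((-1) ^+ c i * b i)
  = (-1) ^+ (\big[addb/false]_(i <- s) c i) * \prod_(i <- s) b i.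
Proof.
elim: s => [|x s IH]; first by rewrite !big_nil mulr1.
rewrite !big_cons IH signr_addb -!mulrA; congr (_ * _).
by rewrite !mulrA; congr (_ * _); apply: commr_sign.
Qed.

Fixpoint inv_sign r (p : 'I_r -> bool) (l : seq 'I_r) : bool :=
  if l is x :: l' then
    (\big[addb/false]_(y <- l') [&& (y < x)%N, p x & p y]) (+) inv_sign p l'
  else false.

Lemma inv_sign_cat r (p : 'I_r -> bool) (l1 : seq 'I_r) (x : 'I_r) l2 :
  (forall y, y \in l1 ++ l2 -> (x < y)%N) ->
  inv_sign p (l1 ++ x :: l2) =
  ((\big[addb/false]_(y <- l1) p y) && p x) (+) inv_sign p (l1 ++ l2).
Proof.
elim: l1 => [|z l1 IH] /= xlt.
  rewrite big_nil /= big1_seq // => y /andP[_ yl2].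
  by rewrite ltnNge ltnW ?xlt.
rewrite IH => [|y yl]; last by rewrite xlt // inE yl orbT.
rewrite !big_cat !big_cons /= xlt ?mem_head //=.
by do 2!case: (p _) => /=; do !case: (bigop _ _ _) => //=; case: (inv_sign _ _).
Qed.

Lemma reorder r (p : 'I_r -> bool) (b : 'I_r -> R) :
  (forall i, homog (p i) (b i)) ->
  forall t l : seq 'I_r, pairwise (fun i j : 'I_r => (i < j)%N) t -> perm_eq l t ->
  \prod_(i <- l) b i = (-1) ^+ (inv_sign p l) * \prod_(i <- t) b i.
Proof.
move=> hb; elim=> [|x t IH] l /=.
  by move=> _ /perm_nilP->; rewrite big_nil mulr1.
case/andP=> /allP xlt pt lt.
have xl: x \in l by rewrite (perm_mem lt) mem_head.
case/splitPr: xl lt => l1 l2 lt.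
have lt' : perm_eq (l1 ++ l2) t.
  by rewrite -(perm_cons x) -(permPr lt) -cat1s perm_catCA.
rewrite inv_sign_cat => [|y]; last by rewrite (perm_mem lt'); apply: xlt.
rewrite signr_addb -mulrA big_cons.
have -> : (-1) ^+ inv_sign p (l1 ++ l2) * (b x * \prod_(j <- t) b j)
  = b x * \prod_(i <- l1 ++ l2) b i.
  by rewrite (IH _ pt lt') !mulrA; congr (_ * _); rewrite commr_sign.
rewrite !big_cat big_cons /= !mulrA; congr (_ * _).
by rewrite (homogC (homog_prod l1 hb) (hb x)) mulrA.
Qed.

Lemma inv_sign_map r (p : 'I_r -> bool) (s : 'I_r -> 'I_r) t :
  pairwise (fun i j : 'I_r => (i < j)%N) t ->
  inv_sign p [seq s i | i <- t] =
  \big[addb/false]_(i <- t) \big[addb/false]_(j <- t)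
    [&& (i < j)%N, (s j < s i)%N, p (s i) & p (s j)].
Proof.
elim: t => [|x t IH] /=; first by rewrite big_nil.
case/andP=> /allP xlt pt; rewrite big_cons (IH pt); congr (_ (+) _).
  rewrite big_map big_cons ltnn /=; apply: eq_big_seq => y yt.
  by rewrite xlt.
apply: eq_big_seq => y yt; rewrite big_cons.
by rewrite (ltnNge y x) ltnW ?xlt.
Qed.

Lemma pairwise_enum_ord r :
  pairwise (fun i j : 'I_r => (i < j)%N) (index_enum 'I_r).
Proof.
rewrite -(pairwise_map val ltn) [index_enum _]unlock -enumT val_enum_ord.
by rewrite -sorted_pairwise ?iota_ltn_sorted //; apply: ltn_trans.
Qed.

Lemma reorder_perm r (s : 'S_r) (p : 'I_r -> bool) (b : 'I_r -> R) :
  (forall i, homog (p i) (b i)) ->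
  \prod_(i < r) b ((s^-1)%g i) =
  (-1) ^+ (\big[addb/false]_(i < r) \big[addb/false]_(j < r)
             [&& (i < j)%N, (s j < s i)%N, p i & p j])
  * \prod_(i < r) b i.
Proof.
move=> hb; rewrite -(big_map (s^-1)%g xpredT b).
rewrite (reorder hb (pairwise_enum_ord r)); last first.
  apply: uniq_perm; rewrite ?map_inj_uniq ?index_enum_uniq //; first exact: perm_inj.
  move=> i; rewrite mem_index_enum; apply/mapP; exists (s i) => //.
  by rewrite permK.
congr ((-1) ^+ (nat_of_bool _) * _).
rewrite (inv_sign_map p (s^-1)%g (pairwise_enum_ord r)).
rewrite (reindex_inj (@perm_inj _ s)) /= exchange_big /=.
rewrite (reindex_inj (@perm_inj _ s)) /=.
by apply: eq_bigr => i _; apply: eq_bigr => j _; rewrite !permK;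
  rewrite andbCA; congr (_ && (_ && _)); apply: andbC.
Qed.

Lemma addb_sym0 r (E : 'I_r -> 'I_r -> bool) :
  (forall i, E i i = false) -> (forall i j : 'I_r, (i < j)%N -> E i j = E j i) ->
  \big[addb/false]_(i < r) \big[addb/false]_(j < r) E i j = false.
Proof.
move=> E0 EC.
have -> : \big[addb/false]_(i < r) \big[addb/false]_(j < r) E i j =
  (\big[addb/false]_(i < r) \big[addb/false]_(j < r) ((i < j)%N && E i j)) (+)
  (\big[addb/false]_(i < r) \big[addb/false]_(j < r) ((j < i)%N && E i j)).
  rewrite -big_split; apply: eq_bigr => i _; rewrite -big_split.
  by apply: eq_bigr => j _ /=; case: ltngtP => //= [_|/val_inj->];
    rewrite ?addbF ?E0.
rewrite [X in _ (+) X]exchange_big -big_split /= big1 // => i _.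
rewrite -big_split /= big1 // => j _.
by case: ltnP => //= ij; rewrite EC // addbb.
Qed.

End Signs.

Section Tensors.
Variables (k : fieldType) (R : superCommAlg k) (r : nat).

Lemma homog_gl (g : GL11 R) i j : homog (i (+) j) (g (basisV R i) j).
Proof.
apply: gl_parity => l; rewrite ffunE; case: eqP => [->|_].
  by rewrite addbb; apply: homog1.
by rewrite /homog linear0.
Qed.

Lemma twistM p (c : bool) (a b : R) :
  homog p a -> twist c (a * b) = twist c a * twist c b.
Proof.
move=> ha; have hb q : homog q (hpart q b : R) by rewrite /homog hpartK eqxx.
have tD (x y : R) : twist c (x + y) = twist c x + twist c y.
  by rewrite /twist !linearD mulrDr addrACA.
rewrite -[in LHS](hpartD b) -[in RHS](hpartD b) mulrDr !tD mulrDr.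
rewrite !(twistE _ (homogM ha (hb _))) !(twistE _ (hb _)) (twistE _ ha).
by case: p {ha} => /=; case: c {tD} => /=; rewrite /= ?mul1r ?mulN1r ?mulrN ?mulNr ?opprK.
Qed.

Lemma homogMt p (a b : R) : homog p a -> a * b = twist p b * a.
Proof.
move=> ha; have hb q : homog q (hpart q b : R) by rewrite /homog hpartK eqxx.
rewrite -[in LHS](hpartD b) mulrDr (homogC ha (hb _)) (homogC ha (hb true)).
by rewrite /twist mulrDl andbF andbT mul1r mulrA.
Qed.

Lemma twistD (c : bool) (a b : R) : twist c (a + b) = twist c a + twist c b.
Proof. by rewrite /twist !linearD mulrDr addrACA. Qed.

Lemma twist_sum (c : bool) (I : Type) (s : seq I) (F : I -> R) :
  twist c (\sum_(i <- s) F i) = \sum_(i <- s) twist c (F i).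
Proof.
elim: s => [|x s IH]; last by rewrite !big_cons twistD IH.
by rewrite !big_nil /twist !linear0 mulr0 addr0.
Qed.

Lemma twist_twist (c d : bool) (a : R) : twist c (twist d a) = twist (c (+) d) a.
Proof.
have hb q : homog q (hpart q a : R) by rewrite /homog hpartK eqxx.
rewrite -(hpartD a) (twistD d) (twistD c) (twistD (c (+) d)).
rewrite !(twistE _ (homog_twist d (hb _))) !(twistE _ (hb _)).
by case: c; case: d; rewrite /= ?mul1r ?mulN1r ?opprK.
Qed.

Lemma prod_mul (q : 'I_r -> bool) (A B : 'I_r -> R) (t : seq 'I_r) :
  (forall i, homog (q i) (A i)) -> pairwise (fun i j : 'I_r => (i < j)%N) t ->
  \prod_(i <- t) (A i * B i) = \prod_(i <- t) A i *
   \prod_(i <- t) twist (\big[addb/false]_(j <- t | (i < j)%N) q j) (B i).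
Proof.
move=> hA; elim: t => [|x t IH] /=; first by rewrite !big_nil mulr1.
case/andP=> /allP xlt pt; rewrite !big_cons ltnn.
under [X in _ = _ * (_ * X)]eq_big_seq => i it.
  rewrite big_cons ltnNge ltnW ?xlt //=; over.
rewrite (IH pt) -!mulrA; congr (_ * _); rewrite !mulrA; congr (_ * _).
have -> : \big[addb/false]_(j <- t | (x < j)%N) q j
        = \big[addb/false]_(j <- t) q j.
  rewrite big_seq_cond [RHS]big_seq; apply: eq_bigl => i.
  by case it: (i \in t) => //=; rewrite xlt.
rewrite (homogMt _ (homog_prod t hA)) twist_twist addbb.
by congr (_ * _); rewrite /twist mul1r hpartD.
Qed.

Lemma basisV_sum (x : superV R) :
  x = \sum_(i : bool) rscale (basisV R i) (x i).
Proof.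
apply/ffunP=> j; rewrite sum_ffunE (bigD1 j) //= big1 => [|i ij].
  by rewrite !ffunE eqxx mul1r addr0.
by rewrite !ffunE eq_sym (negPf ij) mul0r.
Qed.

Lemma GL_act_tens (g : GL11 R) (x : 'I_r -> superV R) :
  GL_act g (tens x) = tens (fun i => g (x i)).
Proof.
have gE y j : g y j = \sum_(i : bool) g (basisV R i) j * y i.
  have g0 : g 0 = 0 by apply: (addrI (g 0)); rewrite -glD !addr0.
  have gs (F : bool -> superV R) : g (\sum_i F i) = \sum_i g (F i).
    by apply: (big_morph g) => //; apply: glD.
  rewrite {1}(basisV_sum y) gs sum_ffunE.
  by apply: eq_bigr => i _; rewrite glZ ffunE.
apply/ffunP=> w; rewrite sum_ffunE [RHS]ffunE.
under [RHS]eq_bigr => i _ do rewrite gE twist_sum.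
rewrite bigA_distr_bigA; apply: eq_bigr => u _; rewrite ffunE !ffunE.
under [RHS]eq_bigr => i _ do rewrite (twistM _ _ (homog_gl _ _ _)).
rewrite (prod_mul (q := fun i => u i (+) w i) _ _ (pairwise_enum_ord r)); last first.
  by move=> i; apply: homog_twist; apply: homog_gl.
congr (_ * _); apply: eq_bigr => i _; rewrite twist_twist -big_split /=.
congr (twist _ _); apply: eq_bigr => j _.
by case: (u j); case: (w j).
Qed.

Lemma tens_perm (g : GL11 R) (s : 'S_r) (u w : word r) :
  (-1) ^+ (\big[addb/false]_(i < r) \big[addb/false]_(j < r)
             [&& (i < j)%N, (s j < s i)%N, u i & u j])
  * tens (fun i => g (basisV R (u ((s^-1)%g i)))) w =
  (-1) ^+ (\big[addb/false]_(i < r) \big[addb/false]_(j < r)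
             [&& (i < j)%N, (s j < s i)%N, w (s i) & w (s j)])
  * tens (fun i => g (basisV R (u i))) [ffun i => w (s i)].
Proof.
pose b i := g (basisV R (u i)) (w (s i)); pose p i := u i (+) w (s i).
have hb i : homog (p i) (b i) by apply: homog_gl.
rewrite !ffunE.
under [X in _ * X = _]eq_bigr => i _.
  rewrite (_ : g _ _ = b ((s^-1)%g i)) ?(twistE _ (hb _)); first over.
  by rewrite /b permKV.
rewrite prod_sign (reorder_perm s hb).
under [X in _ = _ * X]eq_bigr => i _ do rewrite ffunE (twistE _ (hb _)).
rewrite prod_sign !mulrA -!signr_addb; congr ((-1) ^+ (nat_of_bool _) * _).
have H1 : \big[addb/false]_(i < r)
      (p (s^-1 i)%g && \big[addb/false]_(j < r | (i < j)%N) w j) =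
    \big[addb/false]_(i < r) \big[addb/false]_(j < r)
      [&& p i, (s i < s j)%N & w (s j)].
  rewrite (reindex_inj (@perm_inj _ s)) /=; apply: eq_bigr => i _.
  rewrite permK big_mkcond (reindex_inj (@perm_inj _ s)) big_distrr /=.
  by apply: eq_bigr => j _; case: (s i < s j)%N.
have H2 : \big[addb/false]_(i < r) (p i &&
      \big[addb/false]_(j < r | (i < j)%N) [ffun l => w (s l)] j) =
    \big[addb/false]_(i < r) \big[addb/false]_(j < r)
      [&& p i, (i < j)%N & w (s j)].
  apply: eq_bigr => i _; rewrite big_mkcond big_distrr /=.
  by apply: eq_bigr => j _; rewrite ffunE; case: (i < j)%N.
rewrite H1 H2.
have addb0 (x y : bool) : x (+) y = false -> x = y by case: x; case: y.
apply: addb0.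
rewrite -!big_split /=.
under eq_bigr => i _ do rewrite -!big_split /=.
apply: addb_sym0 => [i|i j ij]; first by rewrite !ltnn /= !andbF.
rewrite ij !(ltnNge j i) (ltnW ij) /=.
have: s i != s j by rewrite (inj_eq perm_inj) -val_eqE neq_ltn ij.
rewrite -val_eqE /p /=; case: ltngtP => // _ _ /=;
by case: (u i); case: (u j); case: (w (s i)); case: (w (s j)).
Qed.

End Tensors.

Section EndGL.
Variables (k : fieldType) (r : nat).
Local Notation T := (tensorV r k^o).

Definition homogT (p : bool) (y : T) :=
  forall w, y w != 0 -> word_parity w = p.

Definition GL_equivariant (f : 'End(T)) : Prop :=
  (forall p y, homogT p y -> homogT p (f y)) /\
  (forall (R : superCommAlg k) (g : GL11 R) (y : tensorV r R),
     base_change f (GL_act g y) = GL_act g (base_change f y)).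

Fact GL_equivariant0 : GL_equivariant 0.
Proof.
split=> [p y _ w|R g y]; first by rewrite lfunE ffunE eqxx.
have bc0 (z : tensorV r R) : base_change (0 : 'End(T)) z = 0.
  apply/ffunP=> w; rewrite !ffunE big1 // => u _.
  by rewrite lfunE ffunE scale0r.
rewrite !bc0 /GL_act; apply/ffunP=> w; rewrite sum_ffunE big1 => [|u _].
  by rewrite ffunE.
by rewrite !ffunE mulr0.
Qed.

Fact GL_equivariantL a f h :
  GL_equivariant f -> GL_equivariant h -> GL_equivariant (a *: f + h).
Proof.
move=> [f0 fC] [h0 hC]; split=> [p y yp w|R g y].
  rewrite !lfunE /= !ffunE lfunE ffunE /= => nz.
  have [fw|/(f0 _ _ yp)//] := eqVneq (f y w) 0.
  by apply: (h0 _ _ yp); move: nz; rewrite fw scaler0 add0r.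
have bcL (z : tensorV r R) :
    base_change (a *: f + h) z = a *: base_change f z + base_change h z.
  apply/ffunP=> w; rewrite !ffunE scaler_sumr -big_split; apply: eq_bigr => u _.
  by rewrite !lfunE /= !ffunE lfunE ffunE /= scalerDl scalerA.
rewrite !bcL fC hC /GL_act scaler_sumr -big_split; apply: eq_bigr => u _.
by apply/ffunP=> w; rewrite !ffunE mulrDr scalerAr.
Qed.

Definition EndGL : {vspace 'End(T)} :=
  vspace_of GL_equivariant0 GL_equivariantL.

Lemma EndGL_P f : f \in EndGL <-> GL_equivariant f.
Proof. exact: vspace_ofP. Qed.

(* The exponent <s; e_{u 1}, ..., e_{u r}>. *)
Definition inv_odd (s : 'S_r) (u : word r) : nat :=
  #|[set ij : 'I_r * 'I_r |
      [&& (ij.1 < ij.2)%N, (s ij.2 < s ij.1)%N, u ij.1 & u ij.2]]|.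

Definition perm_word (s : 'S_r) (u : word r) : word r :=
  [ffun i => u ((s^-1)%g i)].

(* e_{u 1} (x) ... (x) e_{u r} |-> (-1)^<s; u> e_{u (s^-1 1)} (x) ...,
   extended linearly. *)
Definition sym_act_fun (s : 'S_r) (y : T) : T :=
  \sum_(u : word r)
     (y u * (-1) ^+ inv_odd s u) *: basisT k^o (perm_word s u).

Definition sym_act (s : 'S_r) : 'End(T) := linfun (sym_act_fun s).

Fact sym_act_fun_linear s : linear (sym_act_fun s).
Proof.
move=> a x y; rewrite /sym_act_fun scaler_sumr -big_split /=.
by apply: eq_bigr => u _; rewrite !ffunE mulrDl scalerDl scalerA mulrA.
Qed.

HB.instance Definition _ s :=
  GRing.isLinear.Build k T T *:%R (sym_act_fun s) (sym_act_fun_linear s).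

Definition unperm_word (s : 'S_r) (w : word r) : word r := [ffun i => w (s i)].

Lemma perm_word_eq s u w : (w == perm_word s u) = (u == unperm_word s w).
Proof.
by apply/eqP/eqP=> ->; apply/ffunP=> i; rewrite !ffunE ?permK ?permKV.
Qed.

Lemma sym_actE s y w :
  sym_act s y w = y (unperm_word s w) * (-1) ^+ inv_odd s (unperm_word s w).
Proof.
rewrite lfunE sum_ffunE (bigD1 (unperm_word s w)) //= big1 => [|u].
  by rewrite !ffunE perm_word_eq eqxx addr0 /GRing.scale /= mulr1.
by rewrite !ffunE perm_word_eq => /negPf->; rewrite scaler0.
Qed.

Lemma odd_inv_odd s u :
  odd (inv_odd s u) = \big[addb/false]_(i < r) \big[addb/false]_(j < r)
     [&& (i < j)%N, (s j < s i)%N, u i & u j].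
Proof.
rewrite /inv_odd -sum1_card (big_morph odd oddD (erefl _)) pair_big /=.
by rewrite [LHS]big_mkcond; apply: eq_bigr => ij _; rewrite inE; case: ifP.
Qed.

Lemma sym_act_equivariant s : GL_equivariant (sym_act s).
Proof.
split=> [p y yp w|R g y].
  rewrite sym_actE => nz; rewrite -(yp (unperm_word s w)).
    rewrite /word_parity (reindex_inj (@perm_inj _ s)).
    by apply: eq_bigr => i _; rewrite ffunE.
  by apply: contraNneq nz => ->; rewrite mul0r.
have bcE (z : tensorV r R) w : base_change (sym_act s) z w =
    (-1) ^+ inv_odd s (unperm_word s w) * z (unperm_word s w).
  rewrite ffunE (bigD1 (unperm_word s w)) //= big1 => [|u nu].
    rewrite sym_actE ffunE eqxx addr0 mul1r.
    rewrite -signr_odd -[in RHS]signr_odd; case: odd; last by rewrite scale1r mul1r.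
    by rewrite scaleN1r mulN1r.
  by rewrite sym_actE ffunE eq_sym (negPf nu) mul0r scale0r.
apply/ffunP=> w; rewrite bcE !sum_ffunE mulr_sumr.
rewrite [RHS](reindex_inj (h := perm_word s)) /=; last first.
  move=> u v /eqP; rewrite perm_word_eq => /eqP->; apply/ffunP=> i.
  by rewrite !ffunE permK.
apply: eq_bigr => u _; rewrite [in LHS]ffunE [in RHS]ffunE bcE.
have -> : unperm_word s (perm_word s u) = u.
  by apply/ffunP=> i; rewrite !ffunE permK.
rewrite !mulrA; congr (_ * _).
have := tens_perm g s u w; rewrite -odd_inv_odd signr_odd => eq_uw.
have -> : (fun i => g (basisV R (perm_word s u i))) =
    (fun i => g (basisV R (u ((s^-1)%g i)))).
  by apply/funext => i; rewrite ffunE.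
rewrite [RHS]commr_sign eq_uw; congr (_ * _); rewrite -[LHS]signr_odd odd_inv_odd.
congr ((-1) ^+ (nat_of_bool _)).
by apply: eq_bigr => i _; apply: eq_bigr => j _; rewrite !ffunE.
Qed.

(* The action on v_1 (x) ... (x) v_r, with v_i homogeneous of parity p i. *)
Lemma sym_act_pure s (p : word r) (v : 'I_r -> superV k) :
  (forall i j, v i j != 0 -> j = p i) ->
  sym_act s [ffun w : word r => \prod_(i < r) v i (w i)] =
  (-1) ^+ inv_odd s p *:
    ([ffun w : word r => \prod_(i < r) v ((s^-1)%g i) (w i)] : T).
Proof.
move=> hv; apply/ffunP=> w; rewrite sym_actE !ffunE /GRing.scale /= mulrC.
rewrite [X in _ = _ * X](reindex_inj (@perm_inj _ s)) /=.
under eq_bigr do rewrite ffunE.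
under [X in _ = _ * X]eq_bigr do rewrite permK.
have [->|nz] := eqVneq (\prod_(i < r) v i (w (s i))) 0; first by rewrite !mulr0.
suff -> : unperm_word s w = p by [].
apply/ffunP=> i; rewrite ffunE; apply: hv.
by move/prodf_neq0: nz; apply.
Qed.

Lemma sym_act1 : sym_act 1%g = \1%VF.
Proof.
apply/lfunP=> y; apply/ffunP=> w; rewrite sym_actE id_lfunE.
have -> : unperm_word 1%g w = w by apply/ffunP=> i; rewrite ffunE perm1.
rewrite -signr_odd odd_inv_odd big1 ?mulr1 // => i _; rewrite big1 // => j _.
by rewrite !perm1; case: ltngtP.
Qed.

(* [(t * s)%g] is "t, then s", i.e. the composite s o t. *)
Lemma sym_actM s t : sym_act (t * s)%g = (sym_act s \o sym_act t)%VF.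
Proof.
apply/lfunP=> y; apply/ffunP=> w; rewrite comp_lfunE !sym_actE.
set u := unperm_word t _.
have -> : unperm_word (t * s)%g w = u.
  by apply/ffunP=> i; rewrite !ffunE permM.
rewrite -mulrA; congr (_ * _).
rewrite -signr_odd -[in RHS]signr_odd -[X in _ = _ * X]signr_odd.
rewrite -signr_addb !odd_inv_odd; congr ((-1) ^+ (nat_of_bool _)).
have -> : \big[addb/false]_(i < r) \big[addb/false]_(j < r)
      [&& (i < j)%N, (s j < s i)%N, unperm_word s w i & unperm_word s w j] =
    \big[addb/false]_(i < r) \big[addb/false]_(j < r)
      [&& (t i < t j)%N, (s (t j) < s (t i))%N, u i & u j].
  rewrite (reindex_inj (@perm_inj _ t)); apply: eq_bigr => i _.
  rewrite (reindex_inj (@perm_inj _ t)); apply: eq_bigr => j _.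
  by rewrite !ffunE.
have addb0 (a b : bool) : a (+) b = false -> a = b by case: a; case: b.
apply: addb0; rewrite -!big_split /=.
under eq_bigr => i _ do rewrite -!big_split /=.
apply: addb_sym0 => [i|i j ij]; first by rewrite !ltnn.
rewrite ij !(ltnNge j i) (ltnW ij) /= !permM.
have nij : i != j by rewrite -val_eqE neq_ltn ij.
have tij : t i != t j :> nat by rewrite val_eqE (inj_eq perm_inj).
have stij : s (t i) != s (t j) :> nat by rewrite val_eqE !(inj_eq perm_inj).
case: (ltngtP (t i) (t j)) tij => //= _ _;
  case: (ltngtP (s (t i)) (s (t j))) stij => //= _ _;
  by case: (u i); case: (u j).
Qed.

Fact sym_act_mem s : sym_act s \in EndGL.
Proof. exact/EndGL_P/sym_act_equivariant. Qed.

(* The underlying vector space of the group algebra k S_r, with basis the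
   permutations. *)
Definition groupAlg := {ffun 'S_r -> k^o}.

Definition Phi_fun (a : groupAlg) : subvs_of EndGL :=
  \sum_(s : 'S_r) (a s : k) *: Subvs (sym_act_mem s).

Definition Phi : 'Hom(groupAlg, subvs_of EndGL) := linfun Phi_fun.

Fact Phi_fun_linear : linear Phi_fun.
Proof.
move=> a x y; rewrite /Phi_fun scaler_sumr -big_split /=.
by apply: eq_bigr => u _; rewrite !ffunE scalerDl scalerA.
Qed.

HB.instance Definition _ :=
  GRing.isLinear.Build k groupAlg (subvs_of EndGL) *:%R Phi_fun Phi_fun_linear.

Lemma PhiE a : vsval (Phi a) = \sum_(s : 'S_r) (a s : k) *: sym_act s.
Proof. by rewrite lfunE /= /Phi_fun linear_sum. Qed.

End EndGL.

(* Main.v *)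
Require Import Defs.
From mathcomp Require Import all_boot all_order all_fingroup all_algebra.
From HB Require Import structures.
From mathcomp Require Import qpoly ring zify.

Set Implicit Arguments.
Unset Strict Implicit.
Unset Printing Implicit Defensive.

Import GRing.Theory.

(** Write V = k e_0 + k e_1, and fix a position z among the r tensor factors.
Call corner of an endomorphism f of the r-th tensor power its matrix
coefficients from u to w, for words u and w that are both odd at z.  The
theorem holds because restriction to the corner identifies both EndGL and the
image of k S_r with the space of weight-preserving matrices on the words of
length r - 1, where the weight counts the odd letters.  That space has dimension
\sum_j 'C(r - 1, j) ^ 2 = 'C(2r - 2, r - 1).

Conceptually, V (x) V^* is coinduced from the trivial representation of the
torus, so End_G (M (x) V) = Hom_G (M (x) V (x) V^*, M) = Hom_T (M, M) for
M = V^{(x) (r - 1)}, in every characteristic.  The proof below is a direct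
form of this argument.

- Weights.  The torus element e_1 |-> e_1 t acts on a word by a power of t.  The
  field k may be finite, so t is taken in k[X] / (X^(r + 2) - 1), where it is
  a unit whose powers 1, t, ..., t^r are linearly independent; an equivariant
  f therefore preserves the weight ([equivariant_weight]).

- The corner determines f ([equivariant_corner_eq0]).  Over the dual numbers
  k[eps], eps odd, the element e_b |-> e_b + e_{~b} eps makes f commute with the
  odd derivation e_b |-> e_{~b}, e_{~b} |-> 0.  If the corner is zero, these
  relations, compared at suitable words, kill first the coefficients from words
  odd at z to words even at z, then those from even to odd, then those from even
  to even.

- Every weight-preserving corner comes from k S_r ([realized_elementary]).  On
  words that are odd at z, the corner of - (i z) is the projection P_i onto the
  words that are odd at i.  Corners of k S_r are stable under left
  multiplication by permutations fixing z, and for distinct i and j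
      2 P_i P_j P_S = (1 - (i j)) (P_i + P_j - 1) P_S,
  since the transposition (i j) acts as -1 on words odd at i and j, as 1 on
  words even at i and j, and P_i + P_j - 1 vanishes on the other words.  As 2
  is invertible, all products of the P_i are obtained, hence all diagonal
  matrices, and permutations fixing z then give the elementary matrices
  between any two words of the same weight. *)

(** * Dual numbers with an odd generator *)

Section DualNumbers.
Local Open Scope ring_scope.
Variable k : fieldType.

Definition dual : Type := (k^o * k^o)%type.
HB.instance Definition _ := GRing.Lmodule.on dual.
Implicit Types x y : dual.

Definition dual_one : dual := (1, 0).
Definition dual_mul x y : dual := (x.1 * y.1, x.1 * y.2 + x.2 * y.1).

Fact dual_mulA : associative dual_mul.
Proof. by move=> x y z; congr pair => /=; ring. Qed.
Fact dual_mulC : commutative dual_mul.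
Proof. by move=> x y; congr pair => /=; ring. Qed.
Fact dual_mul1 : left_id dual_one dual_mul.
Proof. by case=> a b; congr pair => /=; ring. Qed.
Fact dual_mulDl : left_distributive dual_mul +%R.
Proof. by move=> x y z; congr pair; rewrite /= ?mulrDl //; ring. Qed.
Fact dual_one_neq0 : dual_one != 0.
Proof. by apply/eqP => -[/eqP]; rewrite oner_eq0. Qed.

HB.instance Definition _ := GRing.Zmodule_isComNzRing.Build dual
  dual_mulA dual_mulC dual_mul1 dual_mulDl dual_one_neq0.

Fact dual_scaleAl (a : k) x y : a *: (x * y) = (a *: x : dual) * y.
Proof. by congr pair; rewrite /= ?scalerDr -?scalerAl -?scalerAr. Qed.

HB.instance Definition _ := GRing.Lmodule_isLalgebra.Build k dual dual_scaleAl.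
HB.instance Definition _ := GRing.Lalgebra_isComAlgebra.Build k dual.

Definition dual_part (p : bool) x : dual := if p then (0, x.2) else (x.1, 0).

Fact dual_part_linear p : linear (dual_part p).
Proof. by move=> a x y; case: p; congr pair; rewrite /= ?scaler0 ?addr0. Qed.

HB.instance Definition _ p :=
  GRing.isLinear.Build k dual dual *:%R (dual_part p) (dual_part_linear p).

Lemma dual_partP p x :
  dual_part p x = x -> x = if p then (0, x.2) : dual else (x.1, 0).
Proof. by move=> <-; case: p. Qed.

(** The algebra is commutative in the ordinary sense as well, since eps ^ 2 = 0
makes eps * eps = - (eps * eps). *)
Definition dualSCA : superCommAlg k.
Proof.
apply: (@SuperCommAlg k dual (fun p => dual_part p : {linear dual -> dual})).
- by case=> a b; congr pair; rewrite /= ?addr0 ?add0r.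
- by case; case.
- by [].
- by case=> -[] a b /dual_partP -> /dual_partP ->; congr pair => /=; ring.
- move=> p q a b /dual_partP -> /dual_partP ->; rewrite mulr_sign.
  by case: p; case: q; congr pair => /=; ring.
Defined.

End DualNumbers.

(** * The cyclic algebra, purely even *)

Section CyclicAlgebra.
Local Open Scope ring_scope.
Variables (k : fieldType) (N : nat).

(** The group algebra of the cyclic group of order N + 2, for which a generator
comes with N + 2 independent powers whatever the size of k. *)
Definition cyclic_alg : Type := {poly %/ ('X^(N.+2) - 1 : {poly k})}.
HB.instance Definition _ := GRing.ComNzRing.on cyclic_alg.
HB.instance Definition _ := GRing.Lmodule.on cyclic_alg.
Implicit Types x y : cyclic_alg.

Fact cyclic_scaleAl (a : k) x y : a *: (x * y) = a *: x * y.
Proof.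
change (a *: in_qpoly ('X^(N.+2) - 1) ((x : {poly k}) * (y : {poly k})) =
  in_qpoly ('X^(N.+2) - 1) ((a *: (x : {poly k})) * (y : {poly k}))).
by rewrite -in_qpolyZ scalerAl.
Qed.

HB.instance Definition _ :=
  GRing.Lmodule_isLalgebra.Build k cyclic_alg cyclic_scaleAl.
HB.instance Definition _ := GRing.Lalgebra_isComAlgebra.Build k cyclic_alg.

Definition cyclic_gen : cyclic_alg := in_qpoly _ 'X.

Lemma cyclic_modulus_monic : ('X^(N.+2) - 1 : {poly k}) \is monic.
Proof. exact: (monicXnsubC (1 : k)). Qed.

Lemma size_cyclic_modulus : size ('X^(N.+2) - 1 : {poly k}) = N.+3.
Proof. exact: (size_XnsubC (1 : k)). Qed.

Lemma cyclic_mk_monic : mk_monic ('X^(N.+2) - 1 : {poly k}) = 'X^(N.+2) - 1.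
Proof.
by rewrite /mk_monic size_cyclic_modulus cyclic_modulus_monic.
Qed.

Lemma cyclic_genX i : cyclic_gen ^+ i = in_qpoly _ ('X ^+ i).
Proof. by rewrite -rmorphXn. Qed.

Lemma cyclic_gen_order : cyclic_gen ^+ N.+2 = 1.
Proof.
rewrite cyclic_genX -[in RHS](in_qpoly1 ('X^(N.+2) - 1 : {poly k})).
apply/eqP; rewrite -subr_eq0 -linearB; apply/eqP/val_inj => /=.
by rewrite cyclic_mk_monic Pdiv.RingMonic.rmodpp // cyclic_modulus_monic.
Qed.

Lemma cyclic_genX_small i : (i < N.+2)%N -> cyclic_gen ^+ i = 'X^i :> {poly k}.
Proof.
move=> lti; rewrite cyclic_genX in_qpoly_small // cyclic_mk_monic.
by rewrite size_cyclic_modulus size_polyXn.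
Qed.

Lemma cyclic_genX_indep (i j : nat) (c d : k) : (i < N.+2)%N -> (j < N.+2)%N ->
  i != j -> c *: cyclic_gen ^+ i = d *: cyclic_gen ^+ j -> c = 0.
Proof.
move=> lti ltj nij.
have valZ (a : k) l : (a *: cyclic_gen ^+ l : cyclic_alg) =
  a *: (cyclic_gen ^+ l : {poly k}) :> {poly k} by [].
move=> /(congr1 (fun x : cyclic_alg => (x : {poly k})`_i)).
rewrite !valZ !cyclic_genX_small // !coefZ !coefXn eqxx (negPf nij).
by rewrite mulr1 mulr0.
Qed.

Definition even_part (p : bool) x : cyclic_alg := if p then 0 else x.

Fact even_part_linear p : linear (even_part p).
Proof. by move=> a x y; case: p; rewrite /= ?scaler0 ?addr0. Qed.

HB.instance Definition _ p :=
  GRing.isLinear.Build k cyclic_alg cyclic_alg *:%R (even_part p)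
    (even_part_linear p).

Definition cyclicSCA : superCommAlg k.
Proof.
apply: (@SuperCommAlg k cyclic_alg
  (fun p => even_part p : {linear cyclic_alg -> cyclic_alg})) => //=.
- by move=> a; rewrite addr0.
- by case; case.
- by case=> -[] a b /= => [<- _ | <- _ | _ <- | _ _]; rewrite ?(mul0r, mulr0).
- case=> -[] a b /= => [<- _ | <- _ | _ <- | _ _];
    by rewrite ?(mul0r, mulr0, mul1r) // mulrC.
Defined.

End CyclicAlgebra.

(** * Equivariance in coordinates, and the torus *)

Section MatrixCoefficients.
Local Open Scope ring_scope.
Variables (k : fieldType) (r : nat).
Implicit Types (f : 'End(tensorV r k^o)) (u v w : word r).

Definition coef f u w : k := f (basisT k^o u) w.

Definition gl_coef (R : superCommAlg k) (g : GL11 R) u w : R :=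
  tens (fun i => g (basisV R (u i))) w.

Lemma basisTE (A : pzRingType) u w : (basisT A u : tensorV r A) w = (w == u)%:R.
Proof. exact: ffunE. Qed.

Lemma rscaleE (I : finType) (A : pzRingType) (x : {ffun I -> A}) a i :
  rscale x a i = x i * a.
Proof. exact: ffunE. Qed.

(** Equivariance under one element g is the commutation of two matrices over R,
that of f and that of the action of g. *)
Lemma equivariant_coef f (R : superCommAlg k) (g : GL11 R) u w :
  GL_equivariant f ->
  \sum_v coef f v w *: gl_coef g u v = \sum_v coef f u v *: gl_coef g v w.
Proof.
case=> _ /(_ R g (basisT R u)) /(congr1 (fun y : tensorV r R => y w)).
rewrite [LHS]ffunE /GL_act [RHS]sum_ffunE => e.
transitivity (\sum_v coef f v w *:
    (\sum_(t : word r) rscale (tens (fun i => g (basisV R (t i))))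
       ((basisT R u : tensorV r R) t)) v).
  apply: eq_bigr => v _; congr (_ *: _); rewrite sum_ffunE (bigD1 u) //=.
  rewrite big1 ?addr0 => [|t ntu]; first by rewrite rscaleE basisTE eqxx mulr1.
  by rewrite rscaleE basisTE (negPf ntu) mulr0.
rewrite e; apply: eq_bigr => v _; rewrite rscaleE [X in _ * X]ffunE (bigD1 u) //=.
rewrite big1 ?addr0 => [|t ntu]; last by rewrite basisTE (negPf ntu) scaler0.
by rewrite basisTE eqxx -scalerAr mulr1.
Qed.

Lemma coef_lin a f h u w : coef (a *: f + h) u w = a * coef f u w + coef h u w.
Proof. by rewrite /coef !lfunE /= !ffunE lfunE /= ffunE. Qed.

Lemma coef_inj f h : coef f =2 coef h -> f = h.
Proof.
move=> e; apply/lfunP => y; have -> : y = \sum_u y u *: basisT k^o u.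
  apply/ffunP => w; rewrite sum_ffunE (bigD1 w) //= big1 => [|u nuw].
    by rewrite !ffunE eqxx /GRing.scale /= mulr1 addr0.
  by rewrite !ffunE eq_sym (negPf nuw) scaler0.
rewrite !linear_sum; apply: eq_bigr => u _; rewrite !linearZ; congr (_ *: _).
by apply/ffunP => w; apply: e.
Qed.

End MatrixCoefficients.

(** The algebra of coefficients of a [superCommAlg] is not known to be
commutative, which rules out extracting the factor. *)
Lemma prod_eq0 (A : pzRingType) (I : finType) (i : I) (F : I -> A) :
  (F i = 0 -> \prod_j F j = 0)%R.
Proof.
move=> Fi0; have := mem_index_enum i; case/splitPr=> s1 s2.
by rewrite big_cat big_cons /= Fi0 mul0r mulr0.
Qed.

Section Torus.
Local Open Scope ring_scope.
Variables (k : fieldType) (r : nat).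
Implicit Types (f : 'End(tensorV r k^o)) (u v w : word r).

Definition weight u : nat := \sum_i u i.

Lemma weight_le u : (weight u <= r)%N.
Proof.
rewrite -[leqRHS]card_ord -sum1_card; apply: leq_sum => i _.
by case: (u i).
Qed.

Local Notation R := (cyclicSCA k r).
Local Notation t := (cyclic_gen k r : R).

Definition torus_fun (s : R) (x : superV R) : superV R :=
  [ffun i => if i then s * x i else x i].

Lemma torus_funK (s s' : R) : s' * s = 1 -> cancel (torus_fun s) (torus_fun s').
Proof.
by move=> e x; apply/ffunP => -[]; rewrite !ffunE ?mulrA ?e ?mul1r.
Qed.

Definition torus : GL11 R.
Proof.
apply: (@MkGL11 k R (torus_fun t)).
- by move=> x y; apply/ffunP => -[]; rewrite !ffunE ?mulrDr.
- by move=> x a; apply/ffunP => -[]; rewrite !ffunE ?mulrA.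
- move=> p x hx; case; rewrite ffunE; last exact: hx.
  by rewrite -[p (+) true]addFb; apply: homogM; last exact: hx.
- exists (torus_fun (t ^+ r.+1)); apply: torus_funK.
    by rewrite -exprSr cyclic_gen_order.
  by rewrite -exprS cyclic_gen_order.
Defined.

Lemma torus_coef u w :
  gl_coef torus u w = if u == w then t ^+ weight u else 0.
Proof.
rewrite /gl_coef ffunE.
have twist_id b (a : R) : twist b a = a by rewrite /twist /= mulr0 addr0.
case: eqP => [<-|/eqP nuw].
  rewrite /weight -prodrXr; apply: eq_bigr => i _.
  by rewrite twist_id !ffunE eqxx; case: (u i); rewrite ?mulr1.
have [i nui] : exists i, u i != w i.
  apply/existsP; apply: contraNT nuw => /existsPn eqw.
  by apply/eqP/ffunP => i; apply/eqP; rewrite -[_ == _]negbK eqw.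
have zi : (torus (basisV R (u i))) (w i) = 0.
  by rewrite !ffunE [w i == _]eq_sym (negPf nui) mulr0 if_same.
by apply: (prod_eq0 (i := i)); rewrite twist_id.
Qed.

(** Comparing the action of the torus on u and w leaves the single relation
F t ^ weight u = F t ^ weight w, and the powers of t are independent. *)
Lemma equivariant_weight f u w :
  GL_equivariant f -> weight u != weight w -> coef f u w = 0.
Proof.
move=> fE nuw; have := equivariant_coef torus u w fE.
rewrite (bigD1 u) //= big1 => [|v nvu]; last first.
  by rewrite torus_coef eq_sym (negPf nvu) scaler0.
rewrite (bigD1 w) //= big1 => [|v nvw]; last by rewrite torus_coef (negPf nvw) scaler0.
rewrite !torus_coef !eqxx !addr0.
by apply: cyclic_genX_indep => //; rewrite ltnS leqW // weight_le.
Qed.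

End Torus.

(** * Odd one-parameter elements of GL(1|1) *)

Section Shears.
Local Open Scope ring_scope.
Variables (k : fieldType) (r : nat).
Implicit Types (f : 'End(tensorV r k^o)) (u v w : word r) (b : bool).

Local Notation R := (dualSCA k).

Definition dual_eps (c : k) : dual k := (0, c).

(** The right linear map e_b |-> e_b + e_{~b} (c eps), e_{~b} |-> e_{~b}; it is
exp (c eps X) for an odd root vector X of gl(1|1). *)
Definition shear_fun b (c : k) (x : superV R) : superV R :=
  [ffun i => if i == b then x i else x i + (dual_eps c : R) * x b].

Lemma shear_funK b c c' : c + c' = 0 -> cancel (shear_fun b c) (shear_fun b c').
Proof.
move=> e x; apply/ffunP => i; rewrite !ffunE eqxx; case: eqP => // _.
rewrite -addrA -mulrDl -[RHS]addr0; congr (_ + _).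
have -> : (dual_eps c : R) + dual_eps c' = 0; last by rewrite mul0r.
by congr pair => //=; rewrite ?addr0.
Qed.

Definition shear b : GL11 R.
Proof.
apply: (@MkGL11 k R (shear_fun b 1)).
- move=> x y; apply/ffunP => i; rewrite !ffunE; case: eqP => // _.
  by rewrite mulrDr addrACA.
- by move=> x a; apply/ffunP => i; rewrite !ffunE; case: eqP => // _;
    rewrite mulrDl mulrA.
- move=> p x hx i; rewrite ffunE; case: eqP => [_|ib]; first exact: hx.
  have hi : homog (p (+) i) ((dual_eps 1 : R) * x b).
    have -> : p (+) i = true (+) (p (+) b) by case: p i b ib {hx} => -[] [].
    by apply: homogM; last exact: hx.
  by rewrite /homog linearD; congr (_ + _); [exact: hx | exact: hi].
- by exists (shear_fun b (-1)); apply: shear_funK; rewrite ?addrN ?addNr.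
Defined.

Lemma dual_prod1 (I : Type) (s : seq I) (P : pred I) (F : I -> dual k) :
  (\prod_(i <- s | P i) F i).1 = \prod_(i <- s | P i) (F i).1.
Proof. exact: (big_morph (fun x : dual k => x.1 : k)). Qed.

(** Leibniz rule: a factor that is a multiple of eps leaves only the constant
terms of the others. *)
Lemma dual_prod2 (I : finType) (i : I) (F : I -> dual k) : (F i).1 = 0 ->
  (\prod_j F j).2 = (F i).2 * \prod_(j | j != i) (F j).1.
Proof. by move=> Fi; rewrite (bigD1 i) //= Fi mul0r add0r dual_prod1. Qed.

Lemma shear_factor b c i j :
  (twist c (shear b (basisV R i) j) : dual k) =
  ((j == i)%:R, (-1) ^+ c * ((j != b) && (i == b))%:R).
Proof.
rewrite /twist mulr_sign !ffunE.
by case: c; case: b; case: i; case: j; congr pair => /=; ring.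
Qed.

(** The eps-part is the matrix of an odd derivation of the tensor algebra, which
changes one letter at a time. *)
Lemma shear_coef b u w z : u z != w z ->
  (gl_coef (shear b) u w : dual k).2 =
  (-1) ^+ (\big[addb/false]_(j < r | (z < j)%N) w j) * (u z == b)%:R *
  \prod_(i | i != z) (w i == u i)%:R.
Proof.
move=> nuw; rewrite /gl_coef ffunE.
etransitivity; first apply: (@dual_prod2 _ z).
  apply: etrans (congr1 (fun x : dual k => x.1 : k) (shear_factor _ _ _ _)) _.
  by rewrite /= eq_sym (negPf nuw).
congr (_ * _); last first.
  by apply: eq_bigr => i _;
    exact: (congr1 (fun x : dual k => x.1 : k) (shear_factor _ _ _ _)).
apply: etrans (congr1 (fun x : dual k => x.2 : k) (shear_factor _ _ _ _)) _.
congr (_ * _%:R).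
by move: nuw; case: (u z); case: (w z); case: b.
Qed.

Definition flip (z : 'I_r) u : word r := [ffun i => (i == z) (+) u i].

Lemma flipK z : involutive (flip z).
Proof. by move=> u; apply/ffunP => i; rewrite !ffunE addbA addbb. Qed.

Lemma flip_at z u : flip z u z = ~~ u z.
Proof. by rewrite ffunE eqxx. Qed.

Lemma shear_coef_support b u w z : (gl_coef (shear b) u w : dual k).2 != 0 ->
  u z = w z \/ u z = b /\ w = flip z u.
Proof.
have [->|nuw] := eqVneq (u z) (w z); first by left.
rewrite (shear_coef _ nuw) !mulf_eq0 !negb_or.
case/andP=> /andP[_ ub] /prodf_neq0 wu.
right; split; first by apply/eqP; apply: contraNT ub => /negPf->.
apply/ffunP => i; rewrite ffunE; have [->|/wu] := eqVneq i z.
  by move: nuw; case: (u z); case: (w z).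
by move=> nwu; apply/eqP; apply: contraNT nwu => /negPf->.
Qed.

Lemma shear_coef_flip b u z : u z = b ->
  (gl_coef (shear b) u (flip z u) : dual k).2 != 0.
Proof.
move=> ub; rewrite (@shear_coef _ _ _ z); last by rewrite flip_at; case: (u z).
rewrite ub eqxx mulr1 [X in _ * X]big1 ?mulr1 ?signr_eq0 // => i niz.
by rewrite ffunE (negPf niz) eqxx.
Qed.

(** The eps-part of [equivariant_coef]: f commutes with the odd derivation. *)
Lemma equivariant_shear f b u w : GL_equivariant f ->
  \sum_v coef f v w * (gl_coef (shear b) u v : dual k).2 =
  \sum_v coef f u v * (gl_coef (shear b) v w : dual k).2.
Proof.
move=> /(equivariant_coef (shear b) u w) /(congr1 (fun x : dual k => x.2 : k)).
by rewrite !(big_morph (fun x : dual k => x.2 : k) (id1 := 0) (op1 := +%R)).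
Qed.

(** The relation of [equivariant_shear] from u to flip z w.  On the right, the
derivation reaches flip z w either from w or from words that agree with
flip z w at z, so the coefficient from u to w is isolated as soon as the other
terms are known to vanish. *)
Lemma coef_eq0_by_target f b u w z : GL_equivariant f -> w z = b ->
  (forall v, v z = u z -> coef f v (flip z w) = 0) ->
  (u z = b -> coef f (flip z u) (flip z w) = 0) ->
  (forall v, v z = ~~ b -> coef f u v = 0) ->
  coef f u w = 0.
Proof.
move=> fE wb c1 c2 c3; have := equivariant_shear b u (flip z w) fE.
rewrite big1 => [|v _]; last first.
  have [->|] := eqVneq (gl_coef (shear b) u v : dual k).2 0; first by rewrite mulr0.
  by case/(shear_coef_support z) => [/esym/c1 ->|[/c2 uv ->]]; rewrite ?uv mul0r.
rewrite (bigD1 w) //= big1 => [|v nvw].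
  move/esym/eqP; rewrite addr0 mulf_eq0.
  by rewrite (negPf (shear_coef_flip wb)) orbF => /eqP.
have [->|] := eqVneq (gl_coef (shear b) v (flip z w) : dual k).2 0.
  by rewrite mulr0.
case/(shear_coef_support z) => [vw|[_ /(can_inj (flipK z)) wv]].
  by rewrite c3 ?mul0r // vw flip_at wb.
by rewrite wv eqxx in nvw.
Qed.

(** The same relation from flip z u to w, where the term to isolate now stands
on the left. *)
Lemma coef_eq0_by_source f b u w z : GL_equivariant f -> u z = ~~ b ->
  (forall v, v z = w z -> coef f (flip z u) v = 0) ->
  (w z = ~~ b -> coef f (flip z u) (flip z w) = 0) ->
  (forall v, v z = b -> coef f v w = 0) ->
  coef f u w = 0.
Proof.
move=> fE ub c1 c2 c3; have /esym := equivariant_shear b (flip z u) w fE.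
rewrite big1 => [|v _]; last first.
  have [->|] := eqVneq (gl_coef (shear b) v w : dual k).2 0; first by rewrite mulr0.
  case/(shear_coef_support z) => [/c1 ->|[vb wv]]; first by rewrite mul0r.
  by rewrite -[v](flipK z) -wv c2 ?mul0r // wv flip_at vb.
have fub : flip z u z = b by rewrite flip_at ub negbK.
rewrite (bigD1 u) //= big1 => [|v nvu].
  have := shear_coef_flip fub; rewrite flipK => nz.
  by move/esym/eqP; rewrite addr0 mulf_eq0 (negPf nz) orbF => /eqP.
have [->|] := eqVneq (gl_coef (shear b) (flip z u) v : dual k).2 0.
  by rewrite mulr0.
case/(shear_coef_support z) => [uv|[_ vu]]; first by rewrite c3 ?mul0r // -uv.
by rewrite vu flipK eqxx in nvu.
Qed.

(** In block form f = (f_00, f_10; f_01, f_11) according to the letter at z, the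
relations express in turn f_10, f_01 and f_00 by blocks already known to
vanish. *)
Lemma equivariant_corner_eq0 f (z : 'I_r) : GL_equivariant f ->
  (forall u w, u z -> w z -> coef f u w = 0) -> f = 0.
Proof.
move=> fE c11.
have c10 u w : u z -> w z = false -> coef f u w = 0.
  move=> uz wz; apply: (coef_eq0_by_target (b := false) fE wz).
  - by move=> v vu; rewrite c11 ?vu // flip_at wz.
  - by rewrite uz.
  - by move=> v vz; rewrite c11 ?vz.
have c01 u w : u z = false -> w z -> coef f u w = 0.
  move=> uz wz; apply: (coef_eq0_by_source (b := true) fE uz).
  - by move=> v vw; rewrite c11 ?vw // flip_at uz.
  - by rewrite wz.
  - by move=> v vz; rewrite c11 ?vz.
apply: coef_inj => u w; rewrite [RHS]/coef lfunE ffunE.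
case uz: (u z); case wz: (w z); [exact: c11 | exact: c10 | exact: c01 |].
apply: (coef_eq0_by_target (b := false) fE wz).
- by move=> v vu; rewrite c01 ?vu // flip_at wz.
- by move=> _; rewrite c11 // flip_at ?uz ?wz.
- by move=> v vz; rewrite c01 ?vz.
Qed.

End Shears.

(** * Corners of symmetric group elements *)

Section TranspositionSign.
Variable r : nat.
Implicit Types (u : word r) (i j : 'I_r).

Lemma unperm_tperm u i j : u i = u j -> unperm_word (tperm i j) u = u.
Proof.
by move=> uij; apply/ffunP => l; rewrite ffunE; case: tpermP => [->|->|].
Qed.

(** The pairs inverted by (i j), i < j, are (i, j) itself and, for each l
strictly between, (i, l) and (l, j).  When u i = u j, the last two contribute
equally and cancel modulo 2. *)
Lemma inv_odd_tperm u i j : i != j -> u i = u j ->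
  odd (inv_odd (tperm i j) u) = u i.
Proof.
wlog lt_ij : i j / (i < j)%N => [hw nij uij|_ uij].
  have [|lt_ji|/val_inj eij] := ltngtP i j; first by move=> lt; apply: hw.
    by rewrite tpermC uij hw // eq_sym.
  by rewrite eij eqxx in nij.
rewrite odd_inv_odd.
transitivity (\big[addb/false]_(a < r) \big[addb/false]_(b < r)
  (((a == i) && ((b == j) && u i)) (+)
   (((a == i) && [&& (i < b)%N, (b < j)%N, u i & u b]) (+)
    ((b == j) && [&& (i < a)%N, (a < j)%N, u a & u j])))).
  apply: eq_bigr => a _; apply: eq_bigr => b _.
  case: tpermP => [->|->|/eqP bi /eqP bj]; case: tpermP => [->|->|/eqP ai /eqP aj];
    rewrite -?uij; try (move: ai aj); try (move: bi bj); rewrite -?val_eqE /=; lia.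
have pick1 (l : 'I_r) (G : 'I_r -> bool) :
    \big[addb/false]_(a < r) ((a == l) && G a) = G l.
  by rewrite (bigD1 l) //= eqxx big1 ?addbF // => a /negPf->.
under eq_bigr => a _ do rewrite big_split big_split /=.
rewrite big_split big_split /=.
have -> : \big[addb/false]_(a < r) \big[addb/false]_(b < r)
    [&& b == j, (i < a)%N, (a < j)%N, u a & u j] =
  \big[addb/false]_(a < r) \big[addb/false]_(b < r)
    [&& a == i, (i < b)%N, (b < j)%N, u i & u b].
  rewrite [RHS]exchange_big; apply: eq_bigr => a _ /=.
  by rewrite !pick1 -uij [u a && _]andbC.
rewrite addbb addbF exchange_big -[RHS](pick1 j (fun=> u i)).
by apply: eq_bigr => b _; rewrite pick1.
Qed.

End TranspositionSign.

Section Realized.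
Local Open Scope ring_scope.
Variables (k : fieldType) (r : nat) (z : 'I_r).
Implicit Types (f : 'End(tensorV r k^o)) (u v w : word r) (h : word r -> word r -> k).

Definition sym_span f := exists a : groupAlg k r, f = vsval (Phi k r a).

Lemma sym_span_lin a f g : sym_span f -> sym_span g -> sym_span (a *: f + g).
Proof. by case=> x -> [y ->]; exists (a *: x + y); rewrite !linearP. Qed.

Lemma sym_span_act s : sym_span (sym_act k s).
Proof.
exists [ffun t => (t == s)%:R]; rewrite PhiE (bigD1 s) //= big1 => [|t nts].
  by rewrite ffunE eqxx scale1r addr0.
by rewrite ffunE (negPf nts) scale0r.
Qed.

(** The witness is a right translate of the given one because [sym_actM]
reverses products. *)
Lemma sym_span_comp s f : sym_span f -> sym_span (sym_act k s \o f)%VF.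
Proof.
case=> a ->; exists [ffun t => a (t * s^-1)%g]; rewrite !PhiE.
rewrite [RHS](reindex_inj (mulIg s)).
rewrite (big_morph _ (comp_lfunDr (sym_act k s)) (comp_lfun0r _ (sym_act k s))).
by apply: eq_bigr => t _; rewrite ffunE mulgK sym_actM comp_lfunZr.
Qed.

(** Corners are only compared on words odd at z, so h may be any convenient
formula outside them. *)
Definition realized h := exists2 f, sym_span f &
  forall u w, u z -> w z -> coef f u w = h u w.

Lemma eq_realized h h' : (forall u w, u z -> w z -> h u w = h' u w) ->
  realized h -> realized h'.
Proof. by move=> e [f fS fh]; exists f => // u w uz wz; rewrite fh ?e. Qed.

Lemma realized_lin a h h' : realized h -> realized h' ->
  realized (fun u w => a * h u w + h' u w).
Proof.
move=> [f fS fh] [g gS gh]; exists (a *: f + g); first exact: sym_span_lin.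
by move=> u w uz wz; rewrite coef_lin fh ?gh.
Qed.

Lemma realizedZ a h : realized h -> realized (fun u w => a * h u w).
Proof.
move=> hr; apply: eq_realized (realized_lin (a - 1) hr hr) => u w _ _.
by rewrite mulrBl mul1r subrK.
Qed.

(** Only permutations fixing z preserve the words that are odd at z, hence act on
corners. *)
Lemma realized_perm (s : 'S_r) h : s z = z -> realized h ->
  realized (fun u w =>
    h u (unperm_word s w) * (-1) ^+ inv_odd s (unperm_word s w)).
Proof.
move=> sz [f fS fh]; exists (sym_act k s \o f)%VF; first exact: sym_span_comp.
move=> u w uz wz; rewrite /coef comp_lfunE sym_actE -[f _ _]/(coef f u _).
by rewrite fh // ffunE sz.
Qed.

Lemma coef_sym_act s u w : coef (sym_act k s) u w =
  (unperm_word s w == u)%:R * (-1) ^+ inv_odd s (unperm_word s w).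
Proof. by rewrite /coef sym_actE basisTE. Qed.

Definition diag (c : word r -> k) u w : k := (u == w)%:R * c u.

(** With [diag], the projection onto the words odd along ps and even along qs. *)
Definition pattern (ps qs : seq 'I_r) u : k := (all u ps && ~~ has u qs)%:R.

Lemma realized_all_letters : realized (diag (pattern [::] [::])).
Proof.
exists (sym_act k 1%g); first exact: sym_span_act.
move=> u w _ _; rewrite sym_act1 /coef id_lfunE basisTE.
by rewrite /diag /pattern eq_sym mulr1.
Qed.

(** The corner of - (i z).  A word odd at z that (i z) sends to a word odd at z
must be odd at i, and is then an eigenvector for -1. *)
Lemma realized_odd_letter i : i != z -> realized (diag (pattern [:: i] [::])).
Proof.
move=> niz; have [f fS fE] : realized (coef (sym_act k (tperm i z))).
  by exists (sym_act k (tperm i z)) => //; apply: sym_span_act.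
apply: eq_realized (realizedZ (-1) (ex_intro2 _ _ f fS fE)) => u w uz wz.
rewrite coef_sym_act /diag /pattern /= !andbT mulN1r.
set v := unperm_word _ w.
have vi : v i by rewrite ffunE tpermL.
have [uv|nvu] := eqVneq v u; last first.
  have [uw|_] := eqVneq u w; last by rewrite !mul0r oppr0.
  case ui: (u i); last by rewrite mul0r mulr0 oppr0.
  case/eqP: nvu; rewrite /v -uw unperm_tperm ?ui ?uz //.
have ui : u i by rewrite -uv.
rewrite ui uv -signr_odd inv_odd_tperm ?ui ?uz // mul1r expr1 opprK mulr1.
have wi : w i = w z by rewrite wz -uz -uv ffunE tpermR.
by rewrite -uv /v unperm_tperm ?eqxx.
Qed.

(** The identity 2 P_i P_j P_S = (1 - (i j)) (P_i + P_j - 1) P_S: the only place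
where the characteristic matters. *)
Lemma realized_two_odd_letters i j ps : 2%:R != 0 :> k ->
  i != z -> j != z -> i != j ->
  realized (diag (pattern (i :: ps) [::])) ->
  realized (diag (pattern (j :: ps) [::])) ->
  realized (diag (pattern ps [::])) ->
  realized (diag (pattern [:: i, j & ps] [::])).
Proof.
move=> two_neq0 niz njz nij ri rj r0.
have fix_z : tperm i j z = z by rewrite tpermD.
have r1 := realized_lin (-1) r0 (realized_lin 1 ri rj).
have r2 := realizedZ 2%:R^-1 (realized_lin (-1) (realized_perm fix_z r1) r1).
apply: eq_realized r2 => u w _ _; rewrite /diag /pattern /= !andbT.
(* On words with u i = u j the transposition is scalar; on the others the
   middle factor vanishes. *)
have [uij|nuij] := eqVneq (u i) (u j).
  have -> : (u == unperm_word (tperm i j) w) = (u == w).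
    apply/eqP/eqP => [e|<-]; last by rewrite unperm_tperm.
    apply/ffunP => l; rewrite -[in LHS](unperm_tperm uij) e !ffunE.
    by rewrite tpermK.
  have [<-|_] := eqVneq u w; last by rewrite !mul0r; ring.
  rewrite unperm_tperm // -signr_odd inv_odd_tperm // -uij.
  by case: (u i); case: (all u ps) => /=; field.
by case: (u i) (u j) nuij => -[] //= _; case: (all u ps) => /=; ring.
Qed.

Lemma realized_odd_letters ps : 2%:R != 0 :> k -> z \notin ps ->
  realized (diag (pattern ps [::])).
Proof.
move=> two_neq0; have [n] := ubnP (size ps); elim: n ps => // n IH [|i [|j ps]].
- by move=> _ _; apply: realized_all_letters.
- by rewrite inE eq_sym => _; apply: realized_odd_letter.
rewrite !inE !negb_or => /= /ltnSE lt_n /and3P[zi zj zps].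
have [eij|nij] := eqVneq i j.
  apply: eq_realized (IH (j :: ps) _ _) => //; last by rewrite inE negb_or zj.
  by move=> u w _ _; rewrite /diag /pattern /= eij andbA andbb.
apply: realized_two_odd_letters => //; rewrite 1?[_ == z]eq_sym //; apply: IH;
  rewrite ?inE ?negb_or ?zi ?zj //=; lia.
Qed.

(** Even letters are obtained by complement: 1 - P_j projects onto the words even
at j. *)
Lemma realized_pattern ps qs : 2%:R != 0 :> k -> z \notin ps -> z \notin qs ->
  realized (diag (pattern ps qs)).
Proof.
move=> two_neq0; elim: qs ps => [|j qs IH] ps zps.
  by move=> _; apply: realized_odd_letters.
rewrite inE negb_or => /andP[zj zqs].
have r1 : realized (diag (pattern (j :: ps) qs)).
  by apply: IH; rewrite // inE negb_or zj.
apply: eq_realized (realized_lin (-1) r1 (IH ps zps zqs)) => u w _ _.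
rewrite /diag /pattern /=; case: (u j); case: (all u ps); case: (has u qs);
  rewrite /=; ring.
Qed.

Lemma realized_word u0 : 2%:R != 0 :> k -> u0 z ->
  realized (diag (fun u => (u == u0)%:R)).
Proof.
move=> two_neq0 u0z.
pose ps := [seq i <- enum 'I_r | (i != z) && u0 i].
pose qs := [seq i <- enum 'I_r | ~~ u0 i].
have zps : z \notin ps by rewrite mem_filter eqxx.
have zqs : z \notin qs by rewrite mem_filter u0z.
apply: eq_realized (realized_pattern two_neq0 zps zqs) => u w uz _.
congr (_ * (nat_of_bool _)%:R); apply/andP/eqP => [[/allP ups /hasPn uqs]|->].
  apply/ffunP => i; case u0i: (u0 i); last first.
    by apply/negbTE/uqs; rewrite mem_filter u0i mem_enum.
  by have [->//|niz] := eqVneq i z; apply: ups; rewrite mem_filter niz u0i mem_enum.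
split; first by apply/allP => i; rewrite mem_filter => /andP[/andP[]].
by apply/hasPn => i; rewrite mem_filter => /andP[].
Qed.

(** Any permutation s carrying u to w can be corrected to fix z by the
transposition of s z and z, which are both odd positions of w. *)
Lemma weight_perm u w : weight u = weight w -> u z -> w z ->
  exists2 s : 'S_r, s z = z & unperm_word s w = u.
Proof.
move=> uw uz wz.
have : perm_eq [tuple u i | i < r] [tuple w i | i < r].
  apply/allP => b _ /=; apply/eqP.
  have wt v : count_mem true [tuple v i | i < r] = weight v.
    rewrite /= count_map /weight -sum1_count big_mkcond big_enum /=.
    by apply: eq_bigr => i _; case: (v i).
  have wf v : count_mem false [tuple v i | i < r] = (r - weight v)%N.
    rewrite -wt -[X in (X - _)%N](size_tuple [tuple v i | i < r]).
    rewrite -(count_predC (pred1 true)) addKn; apply: eq_count => -[] //.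
  by case: b; rewrite ?wt ?wf uw.
case/tuple_permP=> s es.
have us i : u i = w (s i).
  have := congr1 (fun x => nth false x i) es.
  by rewrite -!tnth_nth !tnth_mktuple.
exists (s * tperm (s z) z)%g; first by rewrite permM tpermL.
apply/ffunP => i; rewrite ffunE permM us.
by case: tpermP => [->|->|//]; rewrite wz -us uz.
Qed.

Lemma realized_elementary u0 w0 : 2%:R != 0 :> k ->
  weight u0 = weight w0 -> u0 z -> w0 z ->
  realized (fun u w => ((u == u0) && (w == w0))%:R).
Proof.
move=> two_neq0 uw uz wz; have [s sz us] := weight_perm uw uz wz.
have r1 := realized_perm sz (realized_word two_neq0 uz).
apply: eq_realized (realizedZ ((-1) ^+ inv_odd s u0) r1) => u w _ _.
rewrite /diag; have [->|nu] := eqVneq u u0; last by rewrite mulr0 mul0r mulr0.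
have -> : (u0 == unperm_word s w) = (w == w0).
  apply/eqP/eqP => [e|-> //]; apply/ffunP => i; move: e; rewrite -us.
  by move/(congr1 (fun v : word r => v (s^-1 i)%g)); rewrite !ffunE permKV.
have [->|_] := eqVneq w w0; last by rewrite !mul0r mulr0.
by rewrite us !mul1r -expr2 sqrr_sign.
Qed.

End Realized.

(** * Counting, and restriction to the corner *)

Section CornerPairs.
Variables (r : nat) (z : 'I_r).

(** Dropping the letter at z leaves the choice of j odd positions among r - 1. *)
Lemma card_corner_words j :
  #|[pred u : word r | u z & weight u == j.+1]| = 'C(r.-1, j).
Proof.
pose f (A : {set 'I_r}) : word r := [ffun i => i \in z |: A].
have weight_f A : weight (f A) = #|z |: A|.
  rewrite -sum1_card /weight [RHS]big_mkcond; apply: eq_bigr => i _.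
  by rewrite ffunE; case: (i \in _).
have avoid_z (A : {set 'I_r}) : (A \subset [set~ z]) = (z \notin A).
  by rewrite subsetC sub1set inE.
have cardC : #|[set~ z]| = r.-1 by rewrite cardsC1 card_ord.
rewrite -cardC -cards_draws -(card_in_imset (f := f)); last first.
  move=> A B; rewrite !inE !avoid_z => /andP[zA _] /andP[zB _] /ffunP fAB.
  apply/setP => i; have := fAB i; rewrite !ffunE !inE.
  by case: eqVneq => //= -> _; rewrite (negPf zA) (negPf zB).
apply: eq_card => u; rewrite [LHS]inE /=.
apply/idP/imsetP => [/andP[uz /eqP wu]|[A]]; last first.
  rewrite inE avoid_z => /andP[zA /eqP cA] ->.
  have fAz : f A z by rewrite ffunE !inE eqxx.
  by rewrite fAz weight_f cardsU1 zA cA /=.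
have fu : f [set i | (i != z) && u i] = u.
  by apply/ffunP => i; rewrite ffunE !inE; case: eqVneq => [->|].
exists [set i | (i != z) && u i] => //.
have zS : z \notin [set i | (i != z) && u i] by rewrite inE eqxx.
have wS : weight u = #|[set i | (i != z) && u i]|.+1.
  by rewrite -[in LHS]fu weight_f cardsU1 zS.
by rewrite inE avoid_z zS -eqSS -wS wu /=.
Qed.

Definition corner_pair : finType :=
  {p : word r * word r | [&& p.1 z, p.2 z & weight p.1 == weight p.2]}.

Lemma card_corner_pair : #|{: corner_pair}| = 'C(2 * r - 2, r - 1).
Proof.
have r_gt0 : 0 < r by apply: leq_trans (ltn_ord z).
have weight_gt0 (u : word r) : u z -> 0 < weight u.
  by move=> uz; rewrite /weight (bigD1 z) //= uz.
rewrite card_sig -sum1_card.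
rewrite (eq_bigl (fun p : word r * word r =>
  p.1 z && (p.2 z && (weight p.1 == weight p.2)))) //.
rewrite -(pair_big_dep (fun u : word r => u z)
  (fun u w : word r => w z && (weight u == weight w)) (fun _ _ => 1)) /=.
transitivity (\sum_(u : word r | u z) 'C(r.-1, (weight u).-1)).
  apply: eq_bigr => u uz; rewrite sum1_card -card_corner_words.
  by apply: eq_card => w; rewrite !inE prednK ?weight_gt0 // eq_sym.
have lt_r (u : word r) : u z -> (weight u).-1 < r.
  by move=> uz; rewrite prednK ?weight_gt0 // weight_le.
have inordE (u : word r) :
    u z -> (inord (weight u).-1 : 'I_r.-1.+1) = (weight u).-1 :> nat.
  by move=> uz; rewrite inordK // [r.-1.+1]prednK // lt_r.
(* Sort by weight minus one, the number j of odd letters away from z. *)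
rewrite (partition_big (fun u => inord (weight u).-1 : 'I_r.-1.+1) xpredT) //=.
transitivity (\sum_(j < r.-1.+1) 'C(r.-1, j) * 'C(r.-1, r.-1 - j)).
  apply: eq_bigr => j _; rewrite bin_sub -1?ltnS //.
  transitivity (\sum_(u : word r | u z && (weight u == j.+1)) 'C(r.-1, j)).
    apply: eq_big => [u|u /andP[uz /eqP<-]]; last by rewrite inordE.
    case uz: (u z) => //=; rewrite -(inj_eq (@ord_inj _)) inordE //.
    by rewrite -eqSS prednK ?weight_gt0.
  by rewrite sum_nat_const card_corner_words.
rewrite binomial.Vandermonde; congr 'C(_, _); lia.
Qed.

End CornerPairs.

Section Restriction.
Local Open Scope ring_scope.
Variables (k : fieldType) (r : nat) (z : 'I_r).
Local Notation E := (EndGL k r).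
Local Notation target := {ffun corner_pair z -> k^o}.

Definition corner_fun (f : subvs_of E) : target :=
  [ffun p : corner_pair z => coef (vsval f) (val p).1 (val p).2 : k^o].

Fact corner_fun_linear : linear corner_fun.
Proof.
by move=> a f g; apply/ffunP => p; rewrite !ffunE linearP coef_lin.
Qed.

HB.instance Definition _ :=
  GRing.isLinear.Build k (subvs_of E) target *:%R corner_fun corner_fun_linear.

Definition corner : 'Hom(subvs_of E, target) := linfun corner_fun.

Lemma cornerE f (p : corner_pair z) :
  corner f p = coef (vsval f) (val p).1 (val p).2.
Proof. by rewrite lfunE ffunE. Qed.

Lemma corner_inj : lker corner == 0%VS.
Proof.
apply/lker0P => f g /eqP; rewrite -subr_eq0 -linearB => /eqP c0.
apply/eqP; rewrite -subr_eq0; apply/eqP/val_inj.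
have fE : GL_equivariant (vsval (f - g)) by apply/EndGL_P/subvsP.
apply: (equivariant_corner_eq0 (z := z) fE) => u w uz wz.
have [uw|nuw] := eqVneq (weight u) (weight w); last exact: equivariant_weight.
have p_in : [&& u z, w z & weight u == weight w] by rewrite uz wz uw eqxx.
have := cornerE (f - g) (exist _ (u, w) p_in : corner_pair z).
by rewrite c0 ffunE => <-.
Qed.

Lemma corner_Phi_full : 2%:R != 0 :> k ->
  (corner @: limg (Phi k r))%VS = fullv.
Proof.
move=> two_neq0; apply/eqP; rewrite eqEsubv subvf; apply/subvP => x _.
have -> : x = \sum_p (x p : k) *: ([ffun q => (q == p)%:R] : target).
  apply/ffunP => q; rewrite sum_ffunE (bigD1 q) //= big1 => [|p npq].
    by rewrite !ffunE eqxx /GRing.scale /= mulr1 addr0.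
  by rewrite !ffunE eq_sym (negPf npq) scaler0.
apply: memv_suml => p _; apply: memvZ.
have [/and3P[p1 p2 /eqP p12]] := (valP p).
have [_ [a ->] fp] := realized_elementary two_neq0 p12 p1 p2.
apply/memv_imgP; exists (Phi k r a); first exact: memv_img (memvf a).
apply/ffunP => q; rewrite cornerE ffunE.
have /and3P[q1 q2 _] := valP q.
by rewrite fp // -val_eqE -pair_eqE.
Qed.

Lemma dim_corner : \dim {: target} = 'C(2 * r - 2, r - 1).
Proof. by rewrite dimvf /dim /= muln1 card_corner_pair. Qed.

End Restriction.

Theorem theorem3p3p1 (k : fieldType) (r : nat)
    (chark : 2%N \notin [pchar k]%R) (r_ge1 : (1 <= r)%N) :
  \dim (EndGL k r) = 'C(2 * r - 2, r - 1) /\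
  'C(2 * r - 2, r - 1) = \dim (limg (Phi k r)).
Proof.
have two_neq0 : (2%:R != 0 :> k)%R by move: chark; rewrite inE.
pose z := Ordinal r_ge1.
have corner_dim (U : {vspace subvs_of (EndGL k r)}) :
    \dim (corner k z @: U)%VS = \dim U.
  by rewrite limg_dim_eq // (eqP (corner_inj k z)) capv0.
have dimPhi : 'C(2 * r - 2, r - 1) = \dim (limg (Phi k r)).
  by rewrite -corner_dim corner_Phi_full // dim_corner.
split=> //; apply/eqP; rewrite eqn_leq; apply/andP; split.
  rewrite -[leqLHS](@dimvf _ (subvs_of (EndGL k r))) -corner_dim.
  by rewrite -(dim_corner k z) dimvS ?subvf.
rewrite dimPhi -[leqRHS](@dimvf _ (subvs_of (EndGL k r))).
by rewrite dimvS ?subvf.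
Qed.
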